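(* Let $p$ be a prime, $r \geq 1$ an integer, and $1 \leq a_1 \leq \dots \leq a_r$ integers, and let $G \simeq C_{p^{a_1}} \oplus \cdots \oplus C_{p^{a_r}}$. Let $\delta$ be an integer with $0 \leq \delta \leq \mathsf{d}(G)-1$ and let $j_0=\min\{i \in \{1,\dots,r\} : a_i=a_r\}$. Then $$\Gamma_{\delta}(G) \geq (p^{a_r}-1)+(r-j_0)(p-1)p^{a_r-1}-\delta-\left\lfloor \frac{\delta}{(r-j_0+1)(p-1)} \right\rfloor.$$
   Context: $C_n$ denotes the cyclic group of order $n$. A sequence in a finite abelian group $G$ is a finite unordered list of elements of $G$ with repetition allowed; its length is the number of terms counted with multiplicity. A sequence is zero-sumfree if no nonempty subsequence (sub-multiset of terms) has sum $0$. $\mathsf{d}(G)$ denotes the maximal length of a zero-sumfree sequence in $G$ (for the group above it equals $\sum_{i=1}^r (p^{a_i}-1)$). $\exp(G)$ is the exponent of $G$; an element has maximal order if its order equals $\exp(G)$. For an integer $\delta$ with $0 \le \delta \le \mathsf{d}(G)-1$, $\Gamma_\delta(G)$ denotes the minimum, over all zero-sumfree sequences $S$ in $G$ with length $|S| \geq \mathsf{d}(G)-\delta$, of the number of terms of $S$ (counted with multiplicity) that have maximal order. *)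

(* Defs.v *)
From mathcomp Require Export all_boot all_order all_algebra all_fingroup all_solvable.

Set Implicit Arguments.
Unset Strict Implicit.
Unset Printing Implicit Defensive.

Import GRing.Theory.

Local Open Scope ring_scope.

(* Sequences in G are represented by [seq G]: none of the notions below depends
   on the order of the terms.  A nonempty subsequence of [s] is given by the
   nonempty set [I] of positions of its terms. *)
Definition zero_sumfree (G : finZmodType) (s : seq G) : bool :=
  [forall I : {set 'I_(size s)}, (I != set0) ==> (\sum_(i in I) s`_i != 0)].

Definition num_max_order (G : finZmodType) (s : seq G) : nat :=
  count (fun x : G => #[x]%g == exponent [set: G]) s.

(* The maximum may be taken over lengths n < #|G| by [zero_sumfree_size]. *)
Definition small_davenport (G : finZmodType) : nat :=
  \max_(n < #|G| | [exists t : n.-tuple G, zero_sumfree t]) n.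

Lemma zero_sumfree_nil (G : finZmodType) : zero_sumfree ([::] : seq G).
Proof. by apply/forallP=> I; apply/implyP=> /set0Pn[[]]. Qed.

Lemma zero_sumfree_size (G : finZmodType) (s : seq G) :
  zero_sumfree s -> (size s < #|G|)%N.
Proof.
move=> /forallP zsf.
pose f (i : 'I_(size s).+1) : G := \sum_(k < size s | (k < i)%N) s`_k.
suff inj_f : injective f by rewrite -[X in (X <= _)%N]card_ord -(card_codom inj_f) max_card.
suff lt_f (i j : 'I_(size s).+1) : (i < j)%N -> f i != f j.
  move=> i j fij; apply/val_inj/eqP; apply/contraT; rewrite neq_ltn.
  by case/orP=> /lt_f; rewrite fij eqxx.
move=> ltij; have lti : (i < size s)%N by rewrite (leq_trans ltij) // -ltnS.
have /implyP := zsf [set k : 'I_(size s) | (i <= k < j)%N].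
have -> : [set k : 'I_(size s) | (i <= k < j)%N] != set0.
  by apply/set0Pn; exists (Ordinal lti); rewrite inE leqnn.
move=> /(_ isT); apply: contraNneq => fij.
have : f j - f i = 0 by rewrite fij subrr.
rewrite {1}/f (bigID (fun k : 'I_(size s) => (k < i)%N)) /=.
rewrite (eq_bigl (fun k : 'I_(size s) => (k < i)%N)); last first.
  by move=> k; case: (ltnP k i) => [/ltn_trans->|]; rewrite ?andbF.
rewrite -/(f i) addrAC subrr add0r => e; apply/eqP; rewrite -[RHS]e.
by apply: eq_bigl => k; rewrite inE -leqNgt andbC.
Qed.

Lemma small_davenport_ge (G : finZmodType) (s : seq G) :
  zero_sumfree s -> (size s <= small_davenport G)%N.
Proof.
move=> zsf; have lts := zero_sumfree_size zsf.
apply: (@leq_bigmax_cond _ _ (fun n : 'I_#|G| => n : nat) (Ordinal lts)).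
by apply/existsP; exists (in_tuple s).
Qed.

Lemma small_davenport_attained (G : finZmodType) :
  exists2 s : seq G, zero_sumfree s & size s = small_davenport G.
Proof.
have G0 : (0 < #|G|)%N by apply/card_gt0P; exists 0.
pose P (n : 'I_#|G|) := [exists t : n.-tuple G, zero_sumfree t].
have P0 : P (Ordinal G0) by apply/existsP; exists [tuple]; apply: zero_sumfree_nil.
have cP : (0 < #|P|)%N by apply/card_gt0P; exists (Ordinal G0).
have [n Pn dE] := eq_bigmax_cond (fun n : 'I_#|G| => n : nat) cP.
have /existsP[t zt] := Pn.
by exists t; rewrite // size_tuple /small_davenport -dE.
Qed.

Definition Gamma_attains (G : finZmodType) (delta k : nat) : bool :=
  [exists n : 'I_#|G|, (small_davenport G - delta <= n)%N &&
    [exists t : n.-tuple G, zero_sumfree t && (num_max_order t == k)]].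

Lemma Gamma_attainsP (G : finZmodType) (delta k : nat) :
  reflect (exists s : seq G, [/\ zero_sumfree s,
             (small_davenport G - delta <= size s)%N & num_max_order s = k])
          (Gamma_attains G delta k).
Proof.
apply: (iffP existsP) => [[n /andP[len /existsP[t /andP[zt /eqP kE]]]]|].
  by exists t; rewrite size_tuple.
case=> s [zs len kE]; exists (Ordinal (zero_sumfree_size zs)); rewrite len /=.
by apply/existsP; exists (in_tuple s); rewrite zs kE eqxx.
Qed.

Lemma Gamma_attains_ex (G : finZmodType) (delta : nat) :
  exists k, Gamma_attains G delta k.
Proof.
have [s zs sE] := small_davenport_attained G; exists (num_max_order s).
by apply/Gamma_attainsP; exists s; rewrite sE leq_subr.
Qed.

Definition Gamma (G : finZmodType) (delta : nat) : nat :=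
  ex_minn (Gamma_attains_ex G delta).

Lemma Gamma_le (G : finZmodType) (delta : nat) (s : seq G) :
  zero_sumfree s -> (small_davenport G - delta <= size s)%N ->
  (Gamma G delta <= num_max_order s)%N.
Proof.
rewrite /Gamma; case: ex_minnP => m _ min_m zs len.
by apply: min_m; apply/Gamma_attainsP; exists s.
Qed.

Lemma Gamma_attained (G : finZmodType) (delta : nat) :
  exists s : seq G, [/\ zero_sumfree s,
    (small_davenport G - delta <= size s)%N & num_max_order s = Gamma G delta].
Proof. by rewrite /Gamma; case: ex_minnP => m /Gamma_attainsP. Qed.

(* Main.v *)
(* In F_p[G] put z_i = 1 - X^(e_i) for the basis (e_i) of G, so that
   z_i^(p^(a_i)) = 0.  If s is zero-sumfree, the product of the 1 - X^g over the
   terms g of s is nonzero; hence, for any superadditive weights W_i(m) given to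
   the powers z_i^m, the weights of the factors add up to at most
   sum_i W_i(p^(a_i) - 1).  Only terms with all coordinates i >= j0 divisible by p
   fail to have maximal order.  Let M and U count the terms of s of maximal and of
   smaller order, and put k = r - j0 + 1, D = sum_(i < j0) (p^(a_i) - 1).
   - W_i(m) = m for i >= j0 and p m otherwise gives
     M + p U <= p D + k (p^(a_r) - 1);
   - W_i(m) = floor(m / p) for i >= j0 and m otherwise gives
     U <= D + k (p^(a_r - 1) - 1).
   With M + U >= d(G) - delta >= D + k (p^(a_r) - 1) - delta, the first inequality
   yields the bound when floor(delta / (k (p - 1))) + 1 < p^(a_r - 1), and the
   second one otherwise. *)
From HB Require Import structures.
Require Import Defs.
From mathcomp Require Import zify.

Set Implicit Arguments.
Unset Strict Implicit.
Unset Printing Implicit Defensive.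

Import GRing.Theory.
Local Open Scope ring_scope.

(** * The group ring of a finite abelian group *)

Definition group_ring (F : comNzRingType) (G : finZmodType) := {ffun G -> F}.

(** Only the additive structure of [{ffun G -> F}] is copied, which leaves the product free to be
    convolution. *)
HB.instance Definition _ (F : comNzRingType) (G : finZmodType) :=
  GRing.Zmodule.copy (group_ring F G) {ffun G -> F}.

Definition convol (F : comNzRingType) (G : finZmodType) (f g : group_ring F G) :
  group_ring F G := [ffun x => \sum_y f y * g (x - y)].

Definition gbasis (F : comNzRingType) (G : finZmodType) (a : G) :
  group_ring F G := [ffun x => (x == a)%:R].

Lemma convolC (F : comNzRingType) (G : finZmodType) :
  commutative (@convol F G).
Proof.
move=> f g; apply/ffunP=> x; rewrite !ffunE.
rewrite (reindex_inj (inv_inj (fun y => subKr x y))) /=.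
by apply: eq_bigr => y _; rewrite subKr mulrC.
Qed.

Lemma convolA (F : comNzRingType) (G : finZmodType) :
  associative (@convol F G).
Proof.
move=> f g h; apply/ffunP=> x; rewrite !ffunE.
under eq_bigr do rewrite ffunE big_distrr.
under [RHS]eq_bigr do rewrite ffunE big_distrl.
rewrite [RHS]exchange_big; apply: eq_bigr => y _ /=.
rewrite [RHS](reindex_inj (addrI y)); apply: eq_bigr => z _ /=.
by rewrite mulrA opprD addrA [y + z]addrC addrK.
Qed.

Lemma gbasis_convol (F : comNzRingType) (G : finZmodType) (a : G)
    (f : group_ring F G) :
  convol (gbasis F a) f = [ffun x => f (x - a)].
Proof.
apply/ffunP=> x; rewrite !ffunE (bigD1 a) //= !ffunE eqxx mul1r big1 ?addr0 //.
by move=> y /negPf ya; rewrite ffunE ya mul0r.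
Qed.

Lemma convol1l (F : comNzRingType) (G : finZmodType) :
  left_id (gbasis F (0 : G)) (@convol F G).
Proof. by move=> f; rewrite gbasis_convol; apply/ffunP=> x; rewrite ffunE subr0. Qed.

Lemma convolDl (F : comNzRingType) (G : finZmodType) :
  left_distributive (@convol F G) +%R.
Proof.
move=> f g h; apply/ffunP=> x; rewrite !ffunE -big_split.
by apply: eq_bigr => y _; rewrite ffunE mulrDl.
Qed.

Lemma gbasis0_neq0 (F : comNzRingType) (G : finZmodType) :
  gbasis F (0 : G) != 0.
Proof. by apply/eqP=> /ffunP/(_ 0)/eqP; rewrite !ffunE eqxx oner_eq0. Qed.

HB.instance Definition _ (F : comNzRingType) (G : finZmodType) :=
  GRing.Zmodule_isComNzRing.Build (group_ring F G)
    (@convolA F G) (@convolC F G) (@convol1l F G) (@convolDl F G)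
    (@gbasis0_neq0 F G).

Lemma gbasis0 (F : comNzRingType) (G : finZmodType) : gbasis F (0 : G) = 1.
Proof. by []. Qed.

Lemma gbasisD (F : comNzRingType) (G : finZmodType) (a b : G) :
  gbasis F (a + b) = gbasis F a * gbasis F b.
Proof.
rewrite [RHS]gbasis_convol; apply/ffunP=> x.
by rewrite !ffunE subr_eq addrC.
Qed.

Lemma gbasis_sum (F : comNzRingType) (G : finZmodType) (I : finType)
    (P : pred I) (g : I -> G) :
  gbasis F (\sum_(i | P i) g i) = \prod_(i | P i) gbasis F (g i).
Proof. exact: (big_morph _ (@gbasisD F G) (gbasis0 F G)). Qed.

Lemma gbasisMn (F : comNzRingType) (G : finZmodType) (a : G) n :
  gbasis F (a *+ n) = gbasis F a ^+ n.
Proof. by elim: n => // n IHn; rewrite mulrS gbasisD IHn exprS. Qed.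

Lemma pchar_group_ring (F : comNzRingType) (G : finZmodType) p :
  p \in [pchar F] -> p \in [pchar (group_ring F G)].
Proof.
rewrite !inE => /andP[-> /eqP p0] /=; apply/eqP/ffunP=> x.
have coefMn n : ((n%:R : group_ring F G) : {ffun G -> F}) x = (x == 0)%:R *+ n.
  elim: n => [|n IHn]; first by rewrite ffunE.
  by rewrite !mulrS ffunE IHn -gbasis0 ffunE.
by rewrite coefMn -mulr_natl p0 mul0r ffunE.
Qed.

(* The coefficient at 0 of the expanded product is 1, since only the empty
   subsequence has sum 0. *)
Lemma zero_sumfree_prod_neq0 (F : comNzRingType) (G : finZmodType) (s : seq G) :
  zero_sumfree s -> \prod_(g <- s) (1 - gbasis F g) != 0.
Proof.
move=> /forallP zs; apply/eqP; rewrite (big_nth 0) big_mkord.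
under eq_bigr do rewrite addrC.
rewrite bigA_distr.
have termE (J : {set 'I_(size s)}) :
    \prod_i (if i \in J then - gbasis F s`_i else 1) =
    (-1) ^+ #|J| * gbasis F (\sum_(i in J) s`_i).
  by rewrite -big_mkcond /= prodrN gbasis_sum.
under eq_bigr do rewrite termE.
move=> /ffunP/(_ 0)/eqP; rewrite sum_ffunE (bigD1 set0) //=.
rewrite cards0 big_set0 mul1r ffunE eqxx big1 ?addr0 => [|J J0].
  by rewrite ffunE oner_eq0.
have /negPf sumJ : \sum_(i in J) s`_i != 0 by apply: (implyP (zs J)).
rewrite -signr_odd mulr_sign; case: odd; rewrite !ffunE eq_sym sumJ //.
by rewrite oppr0.
Qed.

(** * Weight filtration by monomials *)

(** This is membership in the ideal generated by the monomials in the [z i] of weight at least [n].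
    The coefficient [c] is any ring element, so monomials need not be independent. *)
Inductive weight_ge (R : comNzRingType) (I : finType) (z : I -> R)
    (W : I -> nat -> nat) : nat -> R -> Prop :=
  | WeightZero n : weight_ge z W n 0
  | WeightMonomial n c (m : I -> nat) :
      (n <= \sum_i W i (m i))%N -> weight_ge z W n (c * \prod_i z i ^+ m i)
  | WeightAdd n x y :
      weight_ge z W n x -> weight_ge z W n y -> weight_ge z W n (x + y).

Definition superadditive (w : nat -> nat) :=
  forall m n, (w m + w n <= w (m + n))%N.

Lemma superadditive_leq w m n : superadditive w -> (m <= n)%N -> (w m <= w n)%N.
Proof.
by move=> wD le_mn; rewrite -(subnKC le_mn) (leq_trans _ (wD _ _)) ?leq_addr.
Qed.

(** Exponents add when monomials are multiplied, and superadditivity turns this into addition of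
    lower bounds on weights. *)
Lemma weight_geM (R : comNzRingType) (I : finType) (z : I -> R)
    (W : I -> nat -> nat) n1 n2 x y :
  (forall i, superadditive (W i)) ->
  weight_ge z W n1 x -> weight_ge z W n2 y -> weight_ge z W (n1 + n2) (x * y).
Proof.
move=> WD hx; elim: hx y => {n1 x} [n1 y _|n1 c m hm y hy|n1 x1 x2 _ IH1 _ IH2 y hy].
- by rewrite mul0r; apply: WeightZero.
- elim: hy hm => {n2 y} [n2 _|n2 d k hk hm|n2 y1 y2 _ IH1 _ IH2 hm].
  + by rewrite mulr0; apply: WeightZero.
  + rewrite mulrACA -big_split /=; under eq_bigr do rewrite -exprD.
    apply: WeightMonomial; rewrite (leq_trans (leq_add hm hk)) // -big_split /=.
    by apply: leq_sum => i _; apply: WD.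
  + by rewrite mulrDr; apply: WeightAdd; [apply: IH1 | apply: IH2].
- by rewrite mulrDl; apply: WeightAdd; [apply: IH1 | apply: IH2].
Qed.

Lemma weight_geW (R : comNzRingType) (I : finType) (z : I -> R)
    (W : I -> nat -> nat) n m x :
  (n <= m)%N -> weight_ge z W m x -> weight_ge z W n x.
Proof.
move=> le_nm hx; elim: hx le_nm => {m x} [m _|m c k hm le_nm|m x y _ IHx _ IHy le_nm].
- exact: WeightZero.
- by apply: WeightMonomial; apply: leq_trans hm.
- by apply: WeightAdd; [apply: IHx | apply: IHy].
Qed.

Lemma weight_ge0 (R : comNzRingType) (I : finType) (z : I -> R)
    (W : I -> nat -> nat) x : weight_ge z W 0 x.
Proof.
have := @WeightMonomial R I z W 0 x (fun=> 0%N) (leq0n _).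
by rewrite big1 ?mulr1 // => i _; rewrite expr0.
Qed.

Lemma weight_ge_exp (R : comNzRingType) (I : finType) (z : I -> R)
    (W : I -> nat -> nat) i k : weight_ge z W (W i k) (z i ^+ k).
Proof.
have le_sum : (W i k <= \sum_j W j (if j == i then k else 0))%N.
  by rewrite (bigD1 i) //= eqxx leq_addr.
have := WeightMonomial z 1 le_sum.
rewrite mul1r (bigD1 i) //= eqxx big1 ?mulr1 // => j /negPf->.
exact: expr0.
Qed.

Lemma weight_ge_prod (R : comNzRingType) (I : finType) (z : I -> R)
    (W : I -> nat -> nat) (T : eqType) (s : seq T) (F : T -> R) (v : T -> nat) :
  (forall i, superadditive (W i)) ->
  {in s, forall t, weight_ge z W (v t) (F t)} ->
  weight_ge z W (\sum_(t <- s) v t) (\prod_(t <- s) F t).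
Proof.
move=> WD; elim: s => [|t s IHs] hF; first by rewrite !big_nil; apply: weight_ge0.
rewrite !big_cons; apply: weight_geM => //; first by apply: hF; rewrite mem_head.
by apply: IHs => u us; apply: hF; rewrite inE us orbT.
Qed.

(** Each [W i] is monotone, so a monomial of such large weight has some exponent at least [N i] and
    vanishes. *)
Lemma weight_ge_eq0 (R : comNzRingType) (I : finType) (z : I -> R)
    (W : I -> nat -> nat) (N : I -> nat) n x :
  (forall i, superadditive (W i)) -> (forall i, z i ^+ N i = 0) ->
  (\sum_i W i (N i).-1 < n)%N -> weight_ge z W n x -> x = 0.
Proof.
move=> WD zN lt_n hx; elim: hx lt_n => {n x} [//|n c m hm|n x y _ IHx _ IHy] lt_n.
  have [i le_Nm|lt_mN] := pickP (fun i => N i <= m i)%N.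
    by rewrite (bigD1 i) //= -(subnKC le_Nm) exprD zN !mul0r mulr0.
  have := leq_trans lt_n hm; rewrite ltnNge => /negP[]; apply: leq_sum => i _.
  apply: superadditive_leq => //; have := lt_mN i.
  by case: (N i) => // k /negbT; rewrite -ltnNge ltnS.
by rewrite IHx // IHy // addr0.
Qed.

(** Elements congruent to 1 modulo an ideal are closed under products: 1 - xy = (1 - x) + x(1 -
    y). *)
Lemma weight_ge_1B_prod (R : comNzRingType) (I : finType) (z : I -> R)
    (W : I -> nat -> nat) n (J : finType) (F : J -> R) :
  (forall i, superadditive (W i)) ->
  (forall j, weight_ge z W n (1 - F j)) ->
  weight_ge z W n (1 - \prod_j F j).
Proof.
move=> WD hF; apply: (big_ind (fun x => weight_ge z W n (1 - x))) => //.
  by rewrite subrr; apply: WeightZero.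
move=> x y hx hy; have -> : 1 - x * y = (1 - x) + x * (1 - y).
  by rewrite mulrBr mulr1 addrA subrK.
apply: WeightAdd => //; rewrite -[n]add0n; apply: weight_geM => //.
exact: weight_ge0.
Qed.

Lemma weight_ge_1BX (R : comNzRingType) (I : finType) (z : I -> R)
    (W : I -> nat -> nat) n x c :
  (forall i, superadditive (W i)) ->
  weight_ge z W n (1 - x) -> weight_ge z W n (1 - x ^+ c).
Proof.
move=> WD hx; rewrite -[c]card_ord -prodr_const.
exact: weight_ge_1B_prod.
Qed.

(* The weighted form of Olson's bound on the Davenport constant of a p-group;
   [W i m] is the weight given to the m-th power of [1 - X^(e i)]. *)
Lemma zero_sumfree_weight_le (p : nat) (G : finZmodType) (I : finType)
    (e : I -> G) (b : I -> nat) (W : I -> nat -> nat) (v : G -> nat)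
    (s : seq G) :
  prime p -> (forall i, e i *+ p ^ b i = 0) ->
  (forall i, superadditive (W i)) ->
  {in s, forall g, exists c k : I -> nat,
     g = \sum_i e i *+ p ^ k i *+ c i /\ forall i, (v g <= W i (p ^ k i))%N} ->
  zero_sumfree s -> (\sum_(g <- s) v g <= \sum_i W i (p ^ b i).-1)%N.
Proof.
move=> p_pr eb WD hs zs; rewrite leqNgt; apply/negP=> lt_v.
pose z i : group_ring 'F_p G := 1 - gbasis 'F_p (e i).
have chp : p \in [pchar (group_ring 'F_p G)].
  by apply: pchar_group_ring; apply: pchar_Fp.
(* The Frobenius map is additive in characteristic p. *)
have zX i k : z i ^+ (p ^ k) = 1 - gbasis 'F_p (e i *+ p ^ k).
  elim: k => [|k IHk]; first by rewrite expr1 mulr1n.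
  rewrite expnSr exprM IHk mulrnA !gbasisMn.
  rewrite -(pFrobenius_autE chp) pFrobenius_autB_comm; last exact: mulrC.
  by rewrite pFrobenius_aut1 pFrobenius_autE.
have := zero_sumfree_prod_neq0 'F_p zs; rewrite (_ : \prod_(_ <- s) _ = 0) ?eqxx //.
apply: (weight_ge_eq0 WD _ lt_v (z := z)) => [i|].
  by rewrite zX eb gbasis0 subrr.
apply: weight_ge_prod => // g /hs[c [k [-> hv]]].
(* X^g is a product of powers of the X^(p^(k i) e_i), and 1 - X^(p^(k i) e_i) is the single power
   z_i^(p^(k i)), of weight at least [v g]. *)
rewrite gbasis_sum; apply: weight_ge_1B_prod => // i.
rewrite gbasisMn; apply: weight_ge_1BX => //; rewrite -zX.
by apply: weight_geW (hv i) _; apply: weight_ge_exp.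
Qed.

(** * Coordinates with respect to a basis *)

Lemma isog_coordinates (G : finZmodType) r (N : 'I_r -> nat) :
  [set: G] \isog [set: {dffun forall i : 'I_r, 'Z_(N i)}] ->
  exists (phi : forall i, {additive G -> 'Z_(N i)}) (e : 'I_r -> G),
    (forall g, (forall i, phi i g = 0) -> g = 0) /\
    (forall i j, phi i (e j) = (i == j)%:R).
Proof.
case/isogP=> f injf imf.
have fD i : nmod_morphism (fun g : G => f g i : 'Z_(N i)).
  split=> [|x y].
    by have := morph1 f => /= ->; rewrite oneg_ffun.
  by have := @morphM _ _ _ f x y (in_setT _) (in_setT _) => /= ->; rewrite mulg_ffun.
pose phi i : {additive G -> 'Z_(N i)} :=
  HB.pack (fun g : G => f g i : 'Z_(N i)) (GRing.isNmodMorphism.Build _ _ _ (fD i)).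
have f_surj (y : {dffun forall i : 'I_r, 'Z_(N i)}) : exists g, f g = y.
  have : y \in (f @* [set: G])%g by rewrite imf inE.
  by case/morphimP=> g _ _ ->; exists g.
have /fin_all_exists[e fe] (j : 'I_r) :
    exists g, forall i, f g i = (i == j)%:R :> 'Z_(N i).
  have [g fg] := f_surj [ffun i => (i == j)%:R].
  by exists g => i; rewrite fg ffunE.
exists phi, e; split=> [g g0|i j]; last exact: fe.
have /injmP f_inj := injf.
apply: f_inj; rewrite ?inE //.
have -> : f 0 = 1%g by apply: morph1.
by apply/ffunP=> i; rewrite oneg_ffun; apply: g0.
Qed.

Lemma coordinatesE (G : finZmodType) r (N : 'I_r -> nat)
    (phi : forall i, {additive G -> 'Z_(N i)}) (e : 'I_r -> G) g :
  (forall g, (forall i, phi i g = 0) -> g = 0) ->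
  (forall i j, phi i (e j) = (i == j)%:R) ->
  g = \sum_i e i *+ (phi i g : nat).
Proof.
move=> phi_inj phi_e; apply/eqP; rewrite -subr_eq0; apply/eqP/phi_inj => i.
rewrite raddfB raddf_sum (bigD1 i) //= raddfMn phi_e eqxx natr_Zp.
rewrite big1 ?addr0 ?subrr // => j ji.
by rewrite raddfMn phi_e eq_sym (negPf ji) mul0rn.
Qed.

(** The bound [1 < N i] ensures that ['Z_(N i)] has [N i] elements: ['Z_0] and ['Z_1] have two by
    convention. *)
Lemma coordinates_order (G : finZmodType) r (N : 'I_r -> nat)
    (phi : forall i, {additive G -> 'Z_(N i)}) (e : 'I_r -> G) i :
  (forall i, 1 < N i)%N ->
  (forall g, (forall i, phi i g = 0) -> g = 0) ->
  (forall i j, phi i (e j) = (i == j)%:R) ->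
  e i *+ N i = 0.
Proof.
move=> N1 phi_inj phi_e; apply: phi_inj => j; rewrite raddfMn phi_e.
case: eqP => [->|_]; last exact: mul0rn.
exact: pchar_Zp.
Qed.

(** Take N_i - 1 copies of each e_i. If a subsequence contains some e_i, its i-th coordinate is the
    number of copies of e_i in it, which lies strictly between 0 and N_i. *)
Lemma small_davenport_coordinates_ge (G : finZmodType) r (N : 'I_r -> nat)
    (phi : forall i, {additive G -> 'Z_(N i)}) (e : 'I_r -> G) :
  (forall i, 1 < N i)%N ->
  (forall i j, phi i (e j) = (i == j)%:R) ->
  (\sum_i (N i).-1 <= small_davenport G)%N.
Proof.
move=> N1 phi_e; pose s := flatten [seq nseq (N i).-1 (e i) | i <- enum 'I_r].
have -> : (\sum_i (N i).-1)%N = size s.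
  rewrite size_flatten /shape -map_comp sumnE big_map big_enum /=.
  by apply: eq_bigr => i _; rewrite size_nseq.
have e_inj : injective e.
  move=> i j eij; have := phi_e i i; rewrite eij phi_e eqxx.
  by case: eqP => // _ /eqP; rewrite eq_sym oner_eq0.
have count_e i : count_mem (e i) s = (N i).-1.
  rewrite count_flatten -map_comp sumnE big_map big_enum /= (bigD1 i) //=.
  rewrite count_nseq /= eqxx mul1n big1 ?addn0 // => j ji.
  by rewrite count_nseq /= (inj_eq e_inj) (negPf ji).
apply: small_davenport_ge; apply/forallP=> J; apply/implyP; apply: contraNneq => sJ.
apply/eqP/setP=> k; rewrite inE; apply/negP=> kJ.
have : s`_k \in s by rewrite mem_nth.
case/flattenP=> _ /mapP[i _ ->] /nseqP[sk _].
have phi_s (l : 'I_(size s)) : phi i s`_l = (s`_l == e i)%:R.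
  have : s`_l \in s by rewrite mem_nth.
  case/flattenP=> _ /mapP[j _ ->] /nseqP[-> _].
  by rewrite phi_e (inj_eq e_inj) eq_sym.
pose c := #|[pred l in J | s`_l == e i]|.
have c_gt0 : (0 < c)%N by apply/card_gt0P; exists k; rewrite !inE kJ sk eqxx.
have c_le : (c <= (N i).-1)%N.
  rewrite -count_e -sum1_count (big_nth 0) big_mkord sum1_card.
  by apply: subset_leq_card; apply/subsetP=> l; rewrite !inE => /andP[].
have : phi i (\sum_(l in J) s`_l) = c%:R.
  rewrite raddf_sum /=; under eq_bigr do rewrite phi_s.
  rewrite -natr_sum /c -sum1_card; congr (_%:R).
  rewrite [RHS](eq_bigl (fun l => (l \in J) && (s`_l == e i))) // big_mkcondr.
  by apply: eq_bigr => l _ /=; case: eqP.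
rewrite sJ raddf0 => /esym c0.
have : (c%:R : 'Z_(N i)) = 0 :> nat by rewrite c0.
rewrite val_Zp_nat // modn_small => [c00|]; first by rewrite c00 in c_gt0.
by rewrite (leq_ltn_trans c_le) // ltn_predL ltnW.
Qed.

(** If g had order p^m with m < n, then p^n would divide p^m times the coordinate, so p would divide
    the coordinate. Hence g has order p^n, which kills G. *)
Lemma max_order_coordinate (G : finZmodType) (p n : nat)
    (phi : {additive G -> 'Z_(p ^ n)}) (g : G) :
  prime p -> (0 < n)%N -> (forall h : G, h *+ p ^ n = 0) ->
  ~~ (p %| (phi g : nat))%N -> #[g]%g == exponent [set: G].
Proof.
move=> p_pr n_gt0 Gn pg.
have pn_gt1 : (1 < p ^ n)%N by rewrite (ltn_exp2l 0) ?prime_gt1.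
have ord_g : #[g]%g = (p ^ n)%N.
  have /(dvdn_pfactor _ _ p_pr)[m le_mn om] : (#[g]%g %| p ^ n)%N.
    by rewrite order_dvdn FinRing.zmodXgE Gn.
  rewrite om; congr (_ ^ _)%N; apply/eqP; rewrite eqn_leq le_mn leqNgt.
  apply: contra pg => lt_mn.
  have /eqP := expg_order g; rewrite om FinRing.zmodXgE => /eqP gm0.
  have : (p ^ n %| phi g * p ^ m)%N.
    have := congr1 phi gm0; rewrite raddf0 raddfMn -[in X in X -> _](natr_Zp (phi g)).
    rewrite -mulrnA => /(congr1 val) /=.
    by rewrite (val_Zp_nat (pn_gt1 : 1 < p ^ n)%N) /dvdn => ->.
  move: (phi g : nat) => x; rewrite -(subnK lt_mn) addnS -addSn expnD.
  rewrite dvdn_pmul2r ?expn_gt0 ?prime_gt0 //.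
  by apply: dvdn_trans; rewrite expnS dvdn_mulr.
rewrite ord_g eqn_dvd -{1}ord_g dvdn_exponent ?inE //=.
by apply/exponentP=> h _; rewrite FinRing.zmodXgE Gn.
Qed.

(** * Numerical estimates and the conclusion *)

Lemma divn_superadditive p : superadditive (divn^~ p).
Proof.
case: p => [//|p] m n; rewrite leq_divRL // mulnDl.
by apply: leq_add; apply: leq_trunc_div.
Qed.

Lemma sum_if_count (T : Type) (Q : pred T) (s : seq T) x y :
  (\sum_(t <- s) (if Q t then x else y) =
   x * count Q s + y * count (predC Q) s)%N.
Proof.
elim: s => [|t s IHs]; first by rewrite big_nil !muln0.
by rewrite big_cons IHs /=; case: (Q t) => /=; lia.
Qed.

Lemma card_ord_geq r j : (0 < j <= r)%N ->
  #|[pred i : 'I_r | (j <= i.+1)%N]| = (r - j + 1)%N.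
Proof.
move=> /andP[j0 jr]; have -> : (r - j + 1 = \sum_(j.-1 <= i < r) 1)%N.
  by rewrite sum_nat_const_nat muln1; lia.
rewrite big_geq_mkord sum1_card; apply: eq_card => i; rewrite !inE.
by case: j j0 {jr}.
Qed.

(** Here q is p^(a_r - 1) and k the number of summands of maximal exponent. With t the floor, the
    last two hypotheses suffice when t >= q - 1. Otherwise p times the third minus the first
    eliminates D and U, and the slack left is (k - 1)(q - t - 2) >= 0. *)
Lemma gamma_arith (p q k delta D M U : nat) :
  (1 < p)%N -> (0 < q)%N -> (0 < k)%N ->
  (M + p * U <= p * D + k * (p * q).-1)%N ->
  (U <= D + k * q.-1)%N ->
  (D + k * (p * q).-1 <= M + U + delta)%N ->
  ((p * q)%:Z - 1) + (k%:Z - 1) * (p%:Z - 1) * q%:Z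
    - delta%:Z - (delta %/ (k * (p - 1)))%:Z <= M%:Z.
Proof.
case: p q k => [|p] [|q] [|k] // p_gt0 _ _ h1 h2 h3.
have pk0 : (0 < k.+1 * (p.+1 - 1))%N by rewrite subn1 muln_gt0.
have := ltn_ceil delta pk0; set t := (delta %/ _)%N; rewrite subn1 /= => ht.
have pqE : ((p.+1 * q.+1).-1 = p * q + p + q)%N by lia.
rewrite pqE in h1 h3; rewrite /= in h2.
suff : (p * q + p + q + k * p * q.+1 <= M + delta + t)%N by lia.
(* After the destruction above, [p], [q] and [k] are the predecessors of the original values, so the
   case [q <= t] is t >= q - 1. *)
have [qt|tq] := leqP q t; first by lia.
rewrite leqNgt; apply/negP=> ltM.
(* These products are the nonlinear facts that [lia] combines linearly with [h1] and [ht]. *)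
have := leq_mul (leqnn p) ltM.
have := leq_mul (leqnn (k * p)%N) tq.
have := leq_mul (leqnn p.+1) h3.
lia.
Qed.

Theorem theorem2p4 (p r : nat) (a : nat -> nat) (G : finZmodType) (delta j0 : nat)
  (p_prime : prime p)
  (r_ge1 : (1 <= r)%N)
  (a_ge1 : (1 <= a 1)%N)
  (a_mono : forall i j : nat, (1 <= i)%N -> (i <= j)%N -> (j <= r)%N -> (a i <= a j)%N)
  (G_iso : [set: G] \isog [set: {dffun forall i : 'I_r, 'Z_(p ^ a i.+1)}])
  (delta_le : (delta < small_davenport G)%N)
  (j0_range : (1 <= j0 <= r)%N)
  (j0_mem : a j0 = a r)
  (j0_min : forall i : nat, (1 <= i <= r)%N -> a i = a r -> (j0 <= i)%N) :
  ((p ^ a r)%:Z - 1) + (r%:Z - j0%:Z) * (p%:Z - 1) * (p ^ (a r - 1))%:Z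
    - delta%:Z - (delta %/ ((r - j0 + 1) * (p - 1)))%:Z
  <= (Gamma G delta)%:Z.
Proof.
(* Ordinals start at 0, so [i] stands for the summand with index [i.+1]; [top] collects those with
   exponent a_r. *)
pose top := [pred i : 'I_r | (j0 <= i.+1)%N].
have p_gt1 := prime_gt1 p_prime; have p_gt0 := prime_gt0 p_prime.
have a_gt0 (i : 'I_r) : (0 < a i.+1)%N by apply: leq_trans a_ge1 _; apply: a_mono.
have a_le (i : 'I_r) : (a i.+1 <= a r)%N by apply: a_mono.
have a_top i : i \in top -> a i.+1 = a r.
  rewrite inE => j0i; apply/eqP; rewrite eqn_leq a_le -j0_mem a_mono //.
  by case/andP: j0_range.
have ar_gt0 : (0 < a r)%N by apply: leq_trans a_ge1 _; apply: a_mono.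
have N_gt1 (i : 'I_r) : (1 < p ^ a i.+1)%N by rewrite (ltn_exp2l 0).
have [phi [e [phi_inj phi_e]]] := isog_coordinates G_iso.
have e_order i : e i *+ p ^ a i.+1 = 0.
  exact: (coordinates_order i N_gt1 phi_inj phi_e).
have G_exp (g : G) : g *+ p ^ a r = 0.
  rewrite (coordinatesE g phi_inj phi_e) -sumrMnl big1 // => i _.
  by rewrite mulrnAC -(subnKC (a_le i)) expnD mulrnA e_order !mul0rn.
pose maxo (g : G) := #[g]%g == exponent [set: G].
(* When g is not of maximal order, p divides all its top coordinates, so a factor p can be moved
   from each coefficient to the basis element. *)
have dec g : exists c k : 'I_r -> nat, g = \sum_i e i *+ p ^ k i *+ c i /\
    forall i, k i = ~~ maxo g && (i \in top) :> nat.
  pose k i : nat := ~~ maxo g && (i \in top).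
  exists (fun i => (phi i g %/ p ^ k i)%N), k; split=> //.
  rewrite {1}(coordinatesE g phi_inj phi_e); apply: eq_bigr => i _.
  rewrite -mulrnA mulnC divnK // /k; case: (boolP (_ && _)) => [/andP[gmax it]|_];
    last by rewrite expn0 dvd1n.
  rewrite expn1; apply: contraNT gmax => pg; have ai := a_top i it.
  by apply: (max_order_coordinate (phi := phi i)); rewrite ?ai.
have [s [zs len_s <-]] := Gamma_attained G delta.
have d_ge := small_davenport_coordinates_ge N_gt1 phi_e.
pose D := (\sum_(i | i \notin top) (p ^ a (i : 'I_r).+1).-1)%N.
have sum_top (W1 W2 : nat -> nat) :
    (\sum_(i < r) (if i \in top then W1 else W2) (p ^ a i.+1).-1 =
     (r - j0 + 1) * W1 (p ^ a r).-1 +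
     \sum_(i | i \notin top) W2 (p ^ a (i : 'I_r).+1).-1)%N.
  rewrite (bigID (mem top)) /=; congr (_ + _)%N.
    rewrite -(card_ord_geq j0_range) -sum_nat_const; apply: eq_bigr => i it.
    by rewrite it a_top.
  by apply: eq_bigr => i /negPf->.
pose U := count (predC maxo) s.
have sizeMU : (num_max_order s + U = size s)%N by rewrite count_predC.
have bound1 : (num_max_order s + p * U <= p * D + (r - j0 + 1) * (p ^ a r).-1)%N.
  rewrite [leqRHS]addnC; have := @zero_sumfree_weight_le p G _ e (fun i => a i.+1)
    (fun i => if i \in top then id else muln p)
    (fun g => if maxo g then 1 else p)%N s p_prime e_order.
  rewrite sum_if_count mul1n sum_top -big_distrr /=; apply=> // [i|g _].
    by case: ifP => _ m n; rewrite ?mulnDr.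
  (* A term of smaller order gets weight p from z_i^p at top indices and from z_i, weighted by p, at
     the others. *)
  have [c [k [gE kE]]] := dec g; exists c, k; split=> // i; rewrite kE.
  by case: (maxo g) => /=; case: (i \in top) => //=; rewrite ?expn1 ?muln1.
have bound2 : (U <= D + (r - j0 + 1) * (p ^ (a r - 1)).-1)%N.
  rewrite [leqRHS]addnC; have := @zero_sumfree_weight_le p G _ e (fun i => a i.+1)
    (fun i => if i \in top then divn^~ p else id)
    (fun g => if maxo g then 0 else 1)%N s p_prime e_order.
  rewrite sum_if_count mul0n mul1n add0n sum_top.
  have -> : ((p ^ a r).-1 %/ p = (p ^ (a r - 1)).-1)%N.
    case: (a r) ar_gt0 => // n _; rewrite subn1 expnS divn_pred mulKn //.
    by rewrite dvdn_mulr // subn1.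
  apply=> // [i|g _].
    by case: ifP => _ //; apply: divn_superadditive.
  (* A term of smaller order gets weight 1 everywhere, since floor(p / p) = 1; at top indices z_i
     itself has weight 0. *)
  have [c [k [gE kE]]] := dec g; exists c, k; split=> // i; rewrite kE.
  by case: (maxo g) => /=; case: (i \in top) => //=; rewrite ?expn1 ?divnn ?p_gt0.
(* The length of [s] is at least d(G) - delta, and d(G) is at least the sum of all p^(a_i) - 1. *)
have bound3 : (D + (r - j0 + 1) * (p ^ a r).-1 <= num_max_order s + U + delta)%N.
  rewrite sizeMU [leqLHS]addnC [leqRHS]addnC -leq_subLR; apply: leq_trans len_s; apply: leq_sub2r.
  have := sum_top id id; rewrite /= => <-; apply: leq_trans d_ge.
  by apply: leq_sum => i _; case: ifP.
have pE : (p ^ a r = p * p ^ (a r - 1))%N by rewrite -expnS subn1 prednK.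
rewrite pE in bound1 bound3 *.
have := gamma_arith p_gt1 _ _ bound1 bound2 bound3.
have -> : (r - j0 + 1)%:Z - 1 = r%:Z - j0%:Z by case/andP: j0_range; lia.
by apply; rewrite ?expn_gt0 ?p_gt0 ?addn1.
Qed.
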